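(* Let $G$ be a finite group with $n=|G|$, with a unitary representation on a finite-dimensional Hilbert space $\mathcal{H}$ (the representing unitary of $g\in G$ is also denoted $g$). Let $|\psi\rangle\in\mathcal{H}$ be a unit vector, and let $(n^{-1},\psi_g)_{g\in G}$ be the pure-state geometrically uniform ensemble with $\psi_g=g|\psi\rangle\langle\psi|g^\dagger$ and average state $\overline{\rho}=\frac1n\sum_{g\in G}\psi_g$. Then the success probability of the pretty good measurement for this ensemble is equal to $$p_{\mathrm{PGM}}=\frac1n\left[\operatorname{tr}\big(\overline{\rho}^{\frac12}\big)\right]^2.$$
   Context: The pretty good measurement (PGM) of an ensemble $(p_i,\rho_i)_i$ with average state $\overline\rho=\sum_ip_i\rho_i$ is given by $M_i=p_i\,\overline\rho^{-1/2}\rho_i\,\overline\rho^{-1/2}$, with the inverse taken on the support of $\overline\rho$; its success probability is $p_{\mathrm{PGM}}=\sum_ip_i\operatorname{tr}(M_i\rho_i)$. Here the index set is $G$, with $p_g=\frac1n$ and $\rho_g=\psi_g$. *)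

(* Defs.v *)
From mathcomp Require Import all_boot all_order all_algebra all_fingroup.
From mathcomp Require Import all_character.
From mathcomp Require Import reals complex.

Set Implicit Arguments.
Unset Strict Implicit.
Unset Printing Implicit Defensive.

Import Order.TTheory GRing.Theory Num.Theory.

Local Open Scope ring_scope.
Local Open Scope sesquilinear_scope.

(* Vectors are columns, so |v> is [v : 'cV_d] and <v| is [v ^t*]. *)

Section FunctionalCalculus.
Variables (C : numClosedFieldType) (d : nat).
Implicit Types (A : 'M[C]_d) (f : C -> C).

(* Meaningful for normal [A] only: [spectralmx A] is then a unitary
   diagonalizing [A], and [mxfun f A] does not depend on which one is
   chosen, by [mxfun_eigenvector]. *)
Definition mxfun f A : 'M[C]_d :=
  invmx (spectralmx A) *m diag_mx (map_mx f (spectral_diag A))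
    *m spectralmx A.

Lemma mxfun_eigenvector f A (a : C) (v : 'rV[C]_d) :
  A \is normalmx -> v *m A = a *: v -> v *m mxfun f A = f a *: v.
Proof.
move=> /orthomx_spectralP defA; rewrite {1}defA /mxfun => vA.
have Pu := spectral_unit A; set P := spectralmx A in Pu vA *.
set w := v *m invmx P.
have wD : w *m diag_mx (spectral_diag A) = a *: w.
  by rewrite /w scalemxAl -vA !mulmxA mulmxK.
suff -> : v *m (invmx P *m diag_mx (map_mx f (spectral_diag A)) *m P)
    = f a *: w *m P by rewrite -scalemxAl mulmxKV.
rewrite !mulmxA -/w; congr (_ *m _); apply/rowP => i.
move/rowP/(_ i): wD; rewrite !mul_mx_diag !mxE => wi.
have [w0|w_neq0] := eqVneq (w 0 i) 0.
  by rewrite /w mxE in w0 *; rewrite w0 mul0r mulr0.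
move: wi; rewrite mulrC; rewrite /w mxE in w_neq0 *.
by move/(mulIf w_neq0)->; rewrite mulrC.
Qed.

Definition mxsqrt A := mxfun sqrtC A.

(* Inverse square root on the support: since 0^-1 = 0 in a field, the kernel
   of [A] is sent to 0. *)
Definition mxisqrt A := mxfun (fun a => (sqrtC a)^-1) A.

End FunctionalCalculus.

Section PrettyGoodMeasurement.
Variables (C : numClosedFieldType) (d : nat) (I : finType).
Variables (p : I -> C) (rho : I -> 'M[C]_d).

Definition avg_state : 'M[C]_d := \sum_i p i *: rho i.

Definition pgm (i : I) : 'M[C]_d :=
  p i *: (mxisqrt avg_state *m rho i *m mxisqrt avg_state).

Definition pgm_success : C := \sum_i p i * \tr (pgm i *m rho i).

End PrettyGoodMeasurement.

Section GeometricallyUniform.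
Variables (C : numClosedFieldType) (gT : finGroupType) (d : nat).

Definition unitary_repr (rG : mx_representation C [set: gT] d) : Prop :=
  forall g : gT, rG g \is unitarymx.

Definition gu_prob (g : gT) : C := (#|gT|%:R)^-1.

Definition gu_state (rG : mx_representation C [set: gT] d) (psi : 'cV[C]_d)
    (g : gT) : 'M[C]_d :=
  rG g *m (psi *m psi ^t*) *m (rG g) ^t*.

End GeometricallyUniform.

(* Main.v *)
(* Every unitary g commutes with the average state rho, hence with
   S = rho^(-1/2). So each outcome is correct with the same conditional
   probability x^2 / n, where x = <psi| S |psi> = tr (S psi_g) for all g;
   averaging the last formula over g gives x = tr (S rho) = tr (rho^(1/2)). *)
Require Import Defs.
From mathcomp Require Import all_boot all_order all_algebra all_fingroup.
From mathcomp Require Import all_character.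
From mathcomp Require Import reals complex.

Import Order.TTheory GRing.Theory Num.Theory.

Local Open Scope ring_scope.
Local Open Scope sesquilinear_scope.

Lemma eq_mxfun (C : numClosedFieldType) (d : nat) (f g : C -> C)
    (A : 'M[C]_d) : f =1 g -> mxfun f A = mxfun g A.
Proof.
by move=> fg; rewrite /mxfun (_ : map_mx f _ = map_mx g (spectral_diag A)) //;
   apply/matrixP => i j; rewrite !mxE fg.
Qed.

(** Both factors are diagonal in the same eigenbasis, so the eigenvalues multiply. *)
Lemma mxfun_mulmxr (C : numClosedFieldType) (d : nat) (f : C -> C)
    (A : 'M[C]_d) :
  A \is normalmx -> mxfun f A *m A = mxfun (fun a => f a * a) A.
Proof.
move=> /orthomx_spectralP defA; rewrite {2}defA /mxfun.
rewrite !mulmxA (mulmxK (spectral_unit A)); congr (_ *m _).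
rewrite -mulmxA mulmx_diag; congr (_ *m diag_mx _).
by apply/rowP => i; rewrite !mxE.
Qed.

(* In an eigenbasis of [A] with eigenvalues [a_i], commuting with [A] means
   [b_ij a_j = a_i b_ij], i.e. [b_ij = 0] unless [a_i = a_j]. *)
Lemma comm_mxfun (C : numClosedFieldType) (d : nat) (f : C -> C)
    (A B : 'M[C]_d) :
  A \is normalmx -> comm_mx B A -> comm_mx B (mxfun f A).
Proof.
rewrite /comm_mx /mxfun => /orthomx_spectralP defA; rewrite {1 2}defA.
have Pu := spectral_unit A; set P := spectralmx A in Pu *.
set D := spectral_diag A => BA.
pose B' := P *m B *m invmx P.
have defB : B = invmx P *m B' *m P by rewrite /B' !mulmxA mulVmx // mul1mx mulmxKV.
have conjM (X Y : 'M[C]_d) :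
    invmx P *m X *m P *m (invmx P *m Y *m P) = invmx P *m (X *m Y) *m P.
  by rewrite !mulmxA mulmxK.
have B'D : B' *m diag_mx D = diag_mx D *m B'.
  move: BA; rewrite defB !conjM => /(congr1 (fun X => P *m X *m invmx P)).
  by rewrite !mulmxA mulmxV // !mul1mx !mulmxK.
rewrite defB !conjM; congr (_ *m _ *m _).
apply/matrixP => i j; move/matrixP/(_ i j): B'D.
rewrite !mul_mx_diag !mul_diag_mx !mxE.
set b := (\sum_k _) => bD.
have [->|b0] := eqVneq b 0; first by rewrite mul0r mulr0.
by move: bD; rewrite mulrC => /(mulIf b0) ->; rewrite mulrC.
Qed.

Lemma mxisqrt_mulmxr (C : numClosedFieldType) (d : nat) (A : 'M[C]_d) :
  A \is normalmx -> mxisqrt A *m A = mxsqrt A.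
Proof.
move=> nA; rewrite /mxisqrt mxfun_mulmxr //; apply: eq_mxfun => a.
(* On the kernel both sides vanish, so a singular [A] is allowed. *)
have [->|a0] := eqVneq a 0; first by rewrite mulr0 sqrtC0.
by rewrite -{2}(sqrtCK a) expr2 mulKf // sqrtC_eq0.
Qed.

(** By cyclicity both traces reduce to the 1 x 1 matrix [w *m S *m v], which acts as a scalar. *)
Lemma mxtrace_rank1_sqr (C : comNzRingType) (d : nat) (S : 'M[C]_d)
    (v : 'cV[C]_d) (w : 'rV[C]_d) :
  \tr (S *m (v *m w) *m S *m (v *m w)) = (\tr (S *m (v *m w))) ^+ 2.
Proof.
rewrite mulmxA mxtrace_mulC [in RHS]mulmxA [in RHS]mxtrace_mulC !mulmxA.
rewrite -[_ *m w *m S *m v]mulmxA -[_ *m w *m (S *m v)]mulmxA (mulmxA w).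
by rewrite [w *m S *m v]mx11_scalar -scalar_mxM !mxtrace_scalar expr2.
Qed.

Section GeometricallyUniformEnsemble.
Variables (C : numClosedFieldType) (gT : finGroupType) (d : nat).
Variables (rG : mx_representation C [set: gT] d) (psi : 'cV[C]_d).
Hypothesis rG_unitary : unitary_repr rG.

Let rho := avg_state (@gu_prob C gT) (gu_state rG psi).

Lemma gu_state1 : gu_state rG psi 1%g = psi *m psi ^t*.
Proof.
by rewrite /gu_state repr_mx1 trmx1 map_mx1 mulmx1 mul1mx.
Qed.

Lemma gu_stateM (h g : gT) :
  gu_state rG psi (h * g)%g = rG h *m gu_state rG psi g *m (rG h) ^t*.
Proof.
by rewrite /gu_state repr_mxM ?inE // trmx_mul map_mxM !mulmxA.
Qed.

(** [rho] is Hermitian: each state is, and the weight 1/n is real. *)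
Lemma avg_gu_state_normal : rho \is normalmx.
Proof.
suff rhoT : rho ^t* = rho by apply/normalmxP; rewrite rhoT.
rewrite /rho /avg_state raddf_sum /= raddf_sum /=; apply: eq_bigr => g _.
rewrite linearZ /= map_mxZ /gu_prob /= fmorphV rmorph_nat; congr (_ *: _).
by rewrite /gu_state !(trmx_mul, map_mxM) /= !trmxCK !mulmxA.
Qed.

(** Conjugation by [rG h] permutes the ensemble through left translation by [h], hence fixes its
    average. *)
Lemma comm_avg_gu_state (h : gT) : comm_mx (rG h) rho.
Proof.
have rhoJ : rG h *m rho *m (rG h) ^t* = rho.
  rewrite /rho /avg_state mulmx_sumr mulmx_suml.
  rewrite [RHS](reindex_inj (mulgI h)) /=; apply: eq_bigr => g _.
  by rewrite gu_stateM -scalemxAr -scalemxAl.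
by rewrite /comm_mx -{2}rhoJ mulmxKtV.
Qed.

Lemma mxtrace_mxisqrt_gu_state (g : gT) :
  \tr (mxisqrt rho *m gu_state rG psi g) = \tr (mxsqrt rho).
Proof.
have const h : \tr (mxisqrt rho *m gu_state rG psi h)
    = \tr (mxisqrt rho *m (psi *m psi ^t*)).
  have Sh : comm_mx (rG h) (mxisqrt rho).
    exact: comm_mxfun avg_gu_state_normal (comm_avg_gu_state h).
  (* [rG h] moves to the left of [mxisqrt rho]; cyclicity then brings it next to its adjoint, where
     the two cancel. *)
  rewrite -{1}[h]mulg1 gu_stateM gu_state1 !mulmxA -Sh.
  by rewrite -!(mulmxA (rG h)) mxtrace_mulC mulmxKtV.
(* The right-hand side becomes the trace of [mxisqrt rho *m rho], an average over the group of equal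
   terms. *)
rewrite -(mxisqrt_mulmxr _ _ _ avg_gu_state_normal) {3}/rho /avg_state mulmx_sumr.
rewrite raddf_sum /= (eq_bigr (fun=> (#|gT|%:R)^-1 * \tr (mxisqrt rho *m gu_state rG psi g))).
  rewrite sumr_const -[RHS]mulr_natl mulrA divff ?mul1r //.
  by rewrite pnatr_eq0 -lt0n; apply/card_gt0P; exists g.
by move=> h _; rewrite -scalemxAr mxtraceZ !const.
Qed.

Lemma pgm_success_gu :
  pgm_success (@gu_prob C gT) (gu_state rG psi) =
    (#|gT|%:R)^-1 * (\tr (mxsqrt rho)) ^+ 2.
Proof.
rewrite /pgm_success /pgm -/rho.
(* One factor 1/n is the prior in the success probability, the other the weight inside [pgm];
   summing n equal terms cancels one of them. *)
rewrite (eq_bigr (fun=> (#|gT|%:R)^-1 * ((#|gT|%:R)^-1 * (\tr (mxsqrt rho)) ^+ 2))).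
  rewrite sumr_const -[LHS]mulr_natl mulrA divff ?mul1r //.
  by rewrite pnatr_eq0 -lt0n; apply/card_gt0P; exists 1%g.
move=> g _; rewrite -scalemxAl mxtraceZ -(mxtrace_mxisqrt_gu_state g).
(* Regrouping as column times row exposes the rank one form. *)
have -> : gu_state rG psi g = (rG g *m psi) *m (psi ^t* *m (rG g) ^t*).
  by rewrite /gu_state !mulmxA.
by rewrite mxtrace_rank1_sqr.
Qed.

End GeometricallyUniformEnsemble.

Theorem lemma14 (R : realType) (gT : finGroupType) (d : nat)
    (rG : mx_representation R[i] [set: gT] d) (psi : 'cV[R[i]]_d) :
  unitary_repr rG ->
  psi ^t* *m psi = 1%:M ->
  pgm_success (@gu_prob R[i] gT) (gu_state rG psi) =
    (#|gT|%:R)^-1 *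
      (\tr (mxsqrt (avg_state (@gu_prob R[i] gT) (gu_state rG psi)))) ^+ 2.
Proof. by move=> rG_unitary _; apply: pgm_success_gu. Qed.
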